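(* Let $G$ be a connected nontrivial graph with $m$ vertices and let $n\geq 2$. Then $$\lambda'(G\boxtimes P_n)=\min\{(3n-2)\lambda(G),\ m+2e(G),\ 2\xi(G)+4,\ 5\delta(G)+1\}.$$
   Context: All graphs are finite, simple and undirected; ''nontrivial'' means having at least two vertices. $P_n$, $C_n$, $K_n$ denote the path, cycle and complete graph on $n$ vertices. For a graph $G$: $e(G)=|E(G)|$; $\delta(G)$ is the minimum degree; $\lambda(G)$ is the edge-connectivity (minimum size of an edge set whose removal disconnects $G$); for an edge $uv$, its edge-degree is $d_G(u)+d_G(v)-2$, and $\xi(G)$ is the minimum edge-degree over all edges of $G$. A restricted edge-cut of a connected graph $G$ is a set $S\subseteq E(G)$ such that $G-S$ is disconnected and every component of $G-S$ has at least $2$ vertices; the restricted edge-connectivity $\lambda'(G)$ is the minimum cardinality of a restricted edge-cut (it exists, e.g., whenever $G$ has at least four vertices and is not a star, and then $\lambda'(G)\le\xi(G)$). The strong product $G\boxtimes H$ has vertex set $V(G)\times V(H)$, with $(x_1,y_1)$ and $(x_2,y_2)$ adjacent iff either $x_1=x_2$ and $y_1y_2\in E(H)$, or $y_1=y_2$ and $x_1x_2\in E(G)$, or $x_1x_2\in E(G)$ and $y_1y_2\in E(H)$. *)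

(* Defs.v *)
(* Simple graphs = symmetric irreflexive relations on a finType. *)
From mathcomp Require Import all_boot.
Set Implicit Arguments. Unset Strict Implicit. Unset Printing Implicit Defensive.

Section Graphs.
Variable T : finType.
Implicit Types (e : rel T) (S : {set {set T}}).

Definition edges e : {set {set T}} :=
  [set [set p.1; p.2] | p in [set p : T * T | e p.1 p.2]].

Definition nedges e : nat := #|edges e|.

Definition deg e (x : T) : nat := #|[set y | e x y]|.

(* minimum degree delta(G) (default #|T| only for the empty vertex set) *)
Definition min_deg e : nat := \big[minn/#|T|]_(x : T) deg e x.

(* minimum edge-degree xi(G): min over edges uv of d(u)+d(v)-2
   (default only used when G has no edge) *)
Definition min_edge_deg e : nat :=
  \big[minn/(2 * #|T|)]_(p : T * T | e p.1 p.2) (deg e p.1 + deg e p.2 - 2).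

Definition del_edges e S : rel T := fun x y => e x y && ([set x; y] \notin S).

Definition disconnected (f : rel T) : bool := ~~ [forall x, forall y, connect f x y].

Definition component (f : rel T) (x : T) : {set T} := [set y | connect f x y].

Definition edge_cut e S : bool := (S \subset edges e) && disconnected (del_edges e S).

Definition restricted_edge_cut e S : bool :=
  edge_cut e S && [forall x, 1 < #|component (del_edges e S) x|].

(* lambda(G): minimum size of an edge cut (default #|E(G)| if none exists) *)
Definition edge_conn e : nat :=
  \big[minn/nedges e]_(S : {set {set T}} | edge_cut e S) #|S|.

(* lambda'(G): minimum size of a restricted edge cut (default #|E(G)| if none) *)
Definition redge_conn e : nat :=
  \big[minn/nedges e]_(S : {set {set T}} | restricted_edge_cut e S) #|S|.

Definition connected e : Prop := forall x y : T, connect e x y.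
End Graphs.

Definition path_rel (n : nat) : rel 'I_n :=
  fun i j => (i.+1 == j :> nat) || (j.+1 == i :> nat).

Definition strong (T1 T2 : finType) (e1 : rel T1) (e2 : rel T2) : rel (T1 * T2) :=
  fun p q => [|| (p.1 == q.1) && e2 p.2 q.2,
                 (p.2 == q.2) && e1 p.1 q.1
               | e1 p.1 q.1 && e2 p.2 q.2].
Arguments path_rel n : clear implicits.

(* Main.v *)
Require Import Defs.
From mathcomp Require Import all_boot zify.
Set Implicit Arguments. Unset Strict Implicit. Unset Printing Implicit Defensive.

(* Cut the vertex set of the product along a side X and look at its slices X_k
   in the n copies of G.  The cut has
     sum_k bnd X_k X_k + sum_k gap X_k X_(k+1)
   edges, where bnd A B counts the pairs (u, v), u in A, v not in B, with u = v
   or uv an edge, and gap A B = bnd A B + bnd B A.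
   - If every slice is nonempty and not full, each bnd term is at least lambda
     and each gap term at least 2 lambda: by submodularity, or, when A and B
     are disjoint (or cover V(G)), by counting degrees.
   - If there are an empty and a full slice, telescoping A |-> gap 0 A along
     the layers between them gives gap 0 V(G) = m + 2e.
   - Otherwise, up to complement and reversal of the path, an empty slice
     precedes a nonempty slice A.  If the layer after A is empty or missing,
     A contains an edge and gap 0 A + bnd A A is at least 2 xi + 4; if it is
     nonempty, the two slices together cost at least 5 delta + 1.
   The four values are attained by B x P_n, V(G) x {0}, {x, y} x {0} and
   {x} x {0, 1}; for n = 2 the last one is not needed, as 4 lambda is smaller. *)

(** * Minima of finite families with a default value *)

Section BigMin.
Variables (I : finType) (P : pred I) (F : I -> nat) (d : nat).

Lemma bigminn_le i : P i -> \big[minn/d]_(j | P j) F j <= F i.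
Proof.
move=> Pi; have := mem_index_enum i; elim: (index_enum I) => //= j s IH.
rewrite inE big_cons => /orP[/eqP<-|/IH le_s]; first by rewrite Pi geq_minl.
by case: ifP => // _; rewrite geq_min le_s orbT.
Qed.

Lemma bigminn_attained :
  \big[minn/d]_(j | P j) F j = d \/
  exists2 i, P i & \big[minn/d]_(j | P j) F j = F i.
Proof.
elim/big_ind: _ => [|x y IHx IHy|i Pi]; [by left| |by right; exists i].
by rewrite /minn; case: ltnP.
Qed.

End BigMin.

(** * Edge cuts as vertex sides, and counting the pairs that cross a side *)

Section Arcs.
Variable T : finType.
Implicit Types (r e : rel T) (A B : {set T}).

(** Pairs are ordered, so for symmetric [r] an edge inside [A] counts twice in [arcs r A A]. The 0-1
    summands let later inequalities be checked pair by pair. *)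
Definition arcs r A B : nat := \sum_u \sum_v [&& u \in A, v \in B & r u v].

Lemma arcsC r A B : symmetric r -> arcs r A B = arcs r B A.
Proof.
move=> rS; rewrite /arcs exchange_big; apply: eq_bigr => u _.
by apply: eq_bigr => v _; rewrite rS; do 2!case: (_ \in _).
Qed.

Lemma arcsE r A B : arcs r A B = \sum_(u in A) #|[set v in B | r u v]|.
Proof.
rewrite /arcs [RHS]big_mkcond; apply: eq_bigr => u _; case: (u \in A) => /=.
  by rewrite -sum1_card [RHS]big_mkcond; apply: eq_bigr => v _; rewrite inE; case: ifP.
by rewrite big1.
Qed.

Definition cut_edges e A : {set {set T}} :=
  [set [set p.1; p.2] | p in
    [set p : T * T | [&& p.1 \in A, p.2 \notin A & e p.1 p.2]]].

Lemma cut_edges_sub e A : cut_edges e A \subset edges e.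
Proof.
apply/subsetP=> s /imsetP[p]; rewrite inE => /and3P[_ _ ep] ->.
by apply/imsetP; exists p; rewrite ?inE.
Qed.

Lemma mem_cut_edges e A u v : symmetric e ->
  e u v -> ([set u; v] \in cut_edges e A) = ((u \in A) != (v \in A)).
Proof.
move=> eS euv; apply/imsetP/idP => [[[x y]]|].
  rewrite inE /= => /and3P[xA yA _] E.
  have ux : u \in [set x; y] by rewrite -E set21.
  have vx : v \in [set x; y] by rewrite -E set22.
  have xu : x \in [set u; v] by rewrite E set21.
  have yu : y \in [set u; v] by rewrite E set22.
  move: ux vx xu yu; rewrite !inE => /orP[]/eqP-> /orP[]/eqP->; rewrite ?xA ?(negbTE yA) // !orbb.
  - by move=> _ /eqP Ey; rewrite Ey xA in yA.
  - by move=> /eqP Ey; rewrite -Ey xA in yA.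
case uA: (u \in A); case vA: (v \in A) => // _.
  by exists (u, v); rewrite // inE /= uA vA euv.
by exists (v, u); rewrite /= 1?setUC // inE /= uA vA eS euv.
Qed.

(** Each cut edge comes from exactly one ordered pair, the one starting in [A], so forgetting the
    order is injective here. *)
Lemma card_cut_edges e A : #|cut_edges e A| = arcs e A (~: A).
Proof.
rewrite card_in_imset => [|[x y] [x' y']].
  rewrite -sum1_card /arcs pair_bigA big_mkcond; apply: eq_bigr => -[u v] _ /=.
  by rewrite !inE; case: ifP.
rewrite !inE /= => /and3P[xA yA _] /and3P[x'A y'A _] E.
have : x \in [set x'; y'] by rewrite -E set21.
have : y \in [set x'; y'] by rewrite -E set22.
rewrite !inE => /orP[]/eqP Ey /orP[]/eqP Ex; subst => //.
- by rewrite x'A in yA.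
- by rewrite x'A in yA.
by rewrite xA in y'A.
Qed.

Lemma leq_arcs_nedges e A : arcs e A (~: A) <= nedges e.
Proof. by rewrite -card_cut_edges subset_leq_card // cut_edges_sub. Qed.

(** Handshake: an edge is the image of exactly the two pairs [(x, y)] and [(y, x)]. *)
Lemma arcs_setT e : symmetric e -> irreflexive e ->
  arcs e [set: T] [set: T] = 2 * nedges e.
Proof.
move=> eS eI; transitivity #|[set p : T * T | e p.1 p.2]|.
  rewrite -sum1_card /arcs pair_bigA [RHS]big_mkcond; apply: eq_bigr => -[u v] _ /=.
  by rewrite !inE; case: ifP.
rewrite -sum1_card (partition_big_imset (fun p => [set p.1; p.2])) /= -/(edges e).
rewrite mulnC -sum_nat_const; apply: eq_bigr => s /imsetP[[x y]]; rewrite inE /= => exy ->.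
have xy : x != y by apply/eqP=> E; rewrite E eI in exy.
transitivity #|[set (x, y); (y, x)]|; last by rewrite cards2 xpair_eqE negb_and xy.
rewrite -sum1_card; apply: eq_bigl => -[u v]; rewrite !inE /= !xpair_eqE.
apply/andP/orP => [[euv /eqP E]|[]/andP[/eqP-> /eqP->]]; last 2 first.
- by split.
- by rewrite eS setUC.
have uv : u != v by apply/eqP=> E'; rewrite E' eI in euv.
have : u \in [set x; y] by rewrite -E set21.
have : v \in [set x; y] by rewrite -E set22.
rewrite !inE => /orP[]/eqP Ev /orP[]/eqP Eu; subst; rewrite ?eqxx in uv *; by [left|right|].
Qed.

Definition proper_side A : bool := (A != set0) && (A != [set: T]).

Lemma proper_sideC A : proper_side (~: A) = proper_side A.
Proof.
have eqC B : (~: A == B) = (A == ~: B) by rewrite -{1}[B]setCK (inj_eq (@setC_inj T)).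
by rewrite /proper_side !eqC setC0 setCT andbC.
Qed.

Lemma proper_sideP A : reflect (exists u v, u \in A /\ v \notin A) (proper_side A).
Proof.
apply: (iffP andP) => [[/set0Pn[u uA] AT]|[u [v [uA vA]]]].
  have : ~: A != set0 by rewrite -setCT (inj_eq (@setC_inj T)).
  by case/set0Pn=> v; rewrite inE => vA; exists u, v.
split; first by apply/set0Pn; exists u.
by apply: contraNneq vA => ->; rewrite inE.
Qed.

Lemma proper_side1 x : 1 < #|T| -> proper_side [set x].
Proof.
move=> T2; apply/andP; split; first by apply/set0Pn; exists x; rewrite inE.
by apply/eqP=> E; have := cards1 x; rewrite E cardsT => E1; rewrite E1 in T2.
Qed.

(** Restrictedness in terms of a side: an edge to a neighbour on the same side survives the deletion
    of [cut_edges e A]. *)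
Definition no_isolated e A :=
  forall u, exists2 v, e u v & (v \in A) = (u \in A).

Lemma del_cut_closed e A : symmetric e ->
  closed (del_edges e (cut_edges e A)) (mem A).
Proof.
move=> eS u v /andP[euv]; rewrite mem_cut_edges // negbK => /eqP; exact.
Qed.

Lemma edge_cut_cut_edges e A : symmetric e -> proper_side A ->
  edge_cut e (cut_edges e A).
Proof.
move=> eS /proper_sideP[u [v [uA vA]]]; rewrite /edge_cut cut_edges_sub /=.
apply/negP => /forallP/(_ u)/forallP/(_ v) /(closed_connect (del_cut_closed eS)).
by move: uA vA; rewrite -!topredE /= => -> /negbTE->.
Qed.

Lemma edge_conn_le e A : symmetric e -> proper_side A ->
  edge_conn e <= arcs e A (~: A).
Proof.
by move=> eS pA; rewrite -card_cut_edges; apply/bigminn_le/edge_cut_cut_edges.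
Qed.

Lemma redge_conn_le e A : symmetric e -> irreflexive e -> proper_side A -> no_isolated e A ->
  redge_conn e <= arcs e A (~: A).
Proof.
move=> eS eI pA iA; rewrite -card_cut_edges; apply/bigminn_le.
rewrite /restricted_edge_cut edge_cut_cut_edges //=; apply/forallP=> u.
have [v euv vA] := iA u.
have uv : u != v by apply/eqP=> E; rewrite E eI in euv.
rewrite -(_ : #|[set u; v]| = 2); last by rewrite cards2 uv.
apply/subset_leq_card/subsetP => w; rewrite !inE => /orP[]/eqP->; first exact: connect0.
by apply/connect1; rewrite /del_edges euv mem_cut_edges // vA eqxx.
Qed.

(** An edge leaving a component of the graph minus [S] must have been deleted. Hence a cut can be
    replaced by a side without growing. *)
Lemma arcs_component_le e S x : symmetric e ->
  arcs e (component (del_edges e S) x) (~: component (del_edges e S) x) <= #|S|.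
Proof.
move=> eS; rewrite -card_cut_edges; apply/subset_leq_card/subsetP=> s.
case/imsetP=> -[u v]; rewrite !inE /= => /and3P[xu xv euv] ->.
by apply: contraNT xv => uvS; apply: connect_trans xu (connect1 _); rewrite /del_edges euv.
Qed.

Lemma del_edges_sym e S : symmetric e -> symmetric (del_edges e S).
Proof. by move=> eS u v; rewrite /del_edges eS setUC. Qed.

Lemma edge_cut_component e S : edge_cut e S ->
  exists x, proper_side (component (del_edges e S) x).
Proof.
case/andP=> _ /forallPn[x /forallPn[y xy]]; exists x; apply/proper_sideP.
by exists x, y; rewrite !inE connect0.
Qed.

Lemma edge_conn_attained e : symmetric e -> 1 < #|T| ->
  exists2 A, proper_side A & arcs e A (~: A) <= edge_conn e.
Proof.
move=> eS T2; case: (bigminn_attained (edge_cut e) (fun S => #|S|) (nedges e)).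
  (* Default value: no side cuts more than [nedges e] edges, so a singleton serves. *)
  rewrite -/(edge_conn e) => ->.
  have /card_gt0P[x _] : 0 < #|T| by apply: leq_trans T2.
  by exists [set x]; rewrite ?proper_side1 // leq_arcs_nedges.
rewrite -/(edge_conn e) => -[S /edge_cut_component[x px] ->].
by exists (component (del_edges e S) x); rewrite ?arcs_component_le.
Qed.

(** A surviving edge at [u] has both ends in one component, hence on the same side of the component
    of [x]. *)
Lemma component_no_isolated e S x : symmetric e ->
  (forall u, 1 < #|component (del_edges e S) u|) ->
  no_isolated e (component (del_edges e S) x).
Proof.
move=> eS big u; have /card_gt1P[v [w [uv uw vw]]] := big u.
have [z zu uz] : exists2 z, z != u & connect (del_edges e S) u z.
  rewrite !inE in uv uw; case: (eqVneq v u) => [E|]; last by exists v.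
  by exists w; rewrite // -E eq_sym.
case/connectP: uz => -[|y p] /=; first by move=> _ E; rewrite E eqxx in zu.
case/andP=> fuy _ _; exists y; first by case/andP: fuy.
have fS : connect_sym (del_edges e S) by apply/sym_connect_sym/del_edges_sym.
by rewrite !inE; apply/esym/(same_connect1r fS).
Qed.

(** The side assumed to exist is the witness when the minimum equals its default. *)
Lemma redge_conn_attained e : symmetric e ->
  (exists2 A, proper_side A & no_isolated e A) ->
  exists A, [/\ proper_side A, no_isolated e A & arcs e A (~: A) <= redge_conn e].
Proof.
move=> eS [A0 pA0 iA0].
case: (bigminn_attained (restricted_edge_cut e) (fun S => #|S|) (nedges e)).
  by rewrite -/(redge_conn e) => ->; exists A0; rewrite leq_arcs_nedges.
rewrite -/(redge_conn e) => -[S /andP[/edge_cut_component[x px] /forallP big] ->].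
exists (component (del_edges e S) x); split=> //; last exact: arcs_component_le.
exact: component_no_isolated.
Qed.

Lemma connected_arcs_gt0 e A : symmetric e -> connected e -> proper_side A ->
  0 < arcs e A (~: A).
Proof.
move=> eS eC /proper_sideP[u [v [uA vA]]].
rewrite -card_cut_edges card_gt0; apply: contraNneq vA => E.
have Acl : closed e (mem A).
  apply: (intro_closed (sym_connect_sym eS)) => x y exy.
  change (x \in A -> y \in A) => xA; have := mem_cut_edges A eS exy; rewrite E inE xA.
  by case: (y \in A).
have uv : (u \in A) = (v \in A) := closed_connect Acl (eC u v).
by rewrite -uv.
Qed.

Lemma deg_le_min_deg e : 1 < #|T| -> exists x, deg e x <= min_deg e.
Proof.
move=> T2; case: (bigminn_attained xpredT (deg e) #|T|) => [|[x _]];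
  rewrite -/(min_deg e) => ->.
  have /card_gt0P[x _] : 0 < #|T| by apply: leq_trans T2.
  by exists x; apply: max_card.
by exists x.
Qed.

Lemma connected_deg_gt0 e x : 1 < #|T| -> connected e -> exists y, e x y.
Proof.
move=> T2 eC; have /proper_sideP[_ [v [_ xv]]] := proper_side1 x T2.
case/connectP: (eC x v) => -[|y p] /=; first by move=> _ E; rewrite E inE eqxx in xv.
by case/andP=> exy _ _; exists y.
Qed.

Lemma edge_deg_le_min_edge_deg e : 1 < #|T| -> connected e ->
  exists x y, e x y /\ deg e x + deg e y - 2 <= min_edge_deg e.
Proof.
move=> T2 eC.
case: (bigminn_attained (fun p : T * T => e p.1 p.2)
  (fun p => deg e p.1 + deg e p.2 - 2) (2 * #|T|)) => [|[[x y] /= exy]];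
  rewrite -/(min_edge_deg e) => ->.
  have /card_gt0P[x _] : 0 < #|T| by apply: leq_trans T2.
  have [y exy] := connected_deg_gt0 x T2 eC; exists x, y; split=> //.
  have : deg e x <= #|T| by apply: max_card.
  have : deg e y <= #|T| by apply: max_card.
  lia.
by exists x, y.
Qed.

End Arcs.

(** * Cut edges inside one copy of the graph and between two adjacent copies *)

Section Boundary.
Variables (T : finType) (e : rel T).
Hypotheses (eS : symmetric e) (eI : irreflexive e).
Implicit Types (A B C : {set T}).

(** Closed neighbourhoods: this is adjacency between consecutive copies in the strong product. *)
Definition rcl : rel T := fun u v => (u == v) || e u v.

Lemma rcl_sym : symmetric rcl.
Proof. by move=> u v; rewrite /rcl eq_sym eS. Qed.

Definition bnd A B := arcs rcl A (~: B).
Definition gap A B := bnd A B + bnd B A.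

Lemma gapC A B : gap A B = gap B A. Proof. exact: addnC. Qed.

Lemma bndC A B : bnd (~: A) (~: B) = bnd B A.
Proof. by rewrite /bnd setCK (arcsC _ _ rcl_sym). Qed.

Lemma gap_setC A B : gap (~: A) (~: B) = gap A B.
Proof. by rewrite /gap !bndC addnC. Qed.

Lemma bndxx A : bnd A A = arcs e A (~: A).
Proof.
apply: eq_bigr => u _; apply: eq_bigr => v _; rewrite inE /rcl.
by have [->|] := eqVneq u v; rewrite ?eI //=; case: (v \in A).
Qed.

Lemma bnd0 A : bnd set0 A = 0.
Proof. by rewrite /bnd arcsE big_set0. Qed.

Lemma gap00 : gap set0 set0 = 0.
Proof. by rewrite /gap bnd0. Qed.

Lemma card_rcl u : #|[set v | rcl u v]| = (deg e u).+1.
Proof.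
by rewrite (_ : [set v | _] = u |: [set v | e u v]) ?cardsU1 ?inE ?eI //;
   apply/setP=> v; rewrite !inE eq_sym.
Qed.

Lemma gap0 A : gap set0 A = \sum_(u in A) (deg e u).+1.
Proof.
rewrite /gap bnd0 /bnd arcsE; apply: eq_bigr => u _; rewrite -card_rcl.
by apply: eq_card => v; rewrite !inE.
Qed.

(** Triangle inequality: a pair [(u, v)] with [u] in [B] is counted by [bnd B A] if [v] is outside
    [A] and, reversed, by [gap set0 A] otherwise. *)
Lemma gap0_le A B : gap set0 B <= gap set0 A + gap A B.
Proof.
rewrite {1 2}/gap !bnd0 !add0n /gap addnCA -[X in X <= _]add0n leq_add //.
rewrite /bnd (arcsC B _ rcl_sym) (arcsC B _ rcl_sym) /arcs -big_split /= leq_sum // => u _.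
rewrite -big_split /= leq_sum // => v _; rewrite !inE.
by case: (u \in A); case: (v \in B) => //=; rewrite addn0.
Qed.

Lemma min_deg_le u : min_deg e <= deg e u.
Proof. exact: bigminn_le. Qed.

Lemma gap0_min A : #|A| * (min_deg e).+1 <= gap set0 A.
Proof. by rewrite gap0 -sum_nat_const leq_sum // => u _; rewrite ltnS min_deg_le. Qed.

(** The closed neighbourhood of [u] has at least [min_deg e + 1] vertices, at most [#|B|] of them in
    [B]. *)
Lemma rcl_out u B : (min_deg e).+1 - #|B| <= #|[set v in ~: B | rcl u v]|.
Proof.
have := min_deg_le u; rewrite -ltnS -card_rcl -(cardsID B).
rewrite (_ : _ :\: B = [set v in ~: B | rcl u v]); last first.
  by apply/setP=> v; rewrite !inE.
have := subset_leq_card (subsetIr [set v | rcl u v] B).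
lia.
Qed.

Lemma bnd_min A B : #|A| * ((min_deg e).+1 - #|B|) <= bnd A B.
Proof. by rewrite /bnd arcsE -sum_nat_const leq_sum // => u _; apply: rcl_out. Qed.

(** Each [u] in [A] is itself outside [B], so it contributes at least 1 even when the truncated
    difference vanishes. *)
Lemma bnd_min_disjoint A B : A :&: B = set0 ->
  #|A| * (min_deg e - #|B|).+1 <= bnd A B.
Proof.
move=> AB; rewrite /bnd arcsE -sum_nat_const leq_sum // => u uA.
have uB : u \notin B by apply/negP=> uB; move/setP/(_ u): AB; rewrite !inE uA uB.
have := rcl_out u B; have : 0 < #|[set v in ~: B | rcl u v]|.
  by apply/card_gt0P; exists u; rewrite !inE uB /rcl eqxx.
lia.
Qed.

(** Uncrossing, checked pair by pair on the memberships of both ends. *)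
Lemma gap_submod A B : bnd (A :&: B) (A :&: B) + bnd (A :|: B) (A :|: B) <= gap A B.
Proof.
rewrite /gap /bnd /arcs -!big_split leq_sum //= => u _.
rewrite -!big_split leq_sum //= => v _; rewrite !inE.
by case: (u \in A); case: (u \in B); case: (v \in A); case: (v \in B); case: (rcl u v).
Qed.

Lemma bnd1 x : bnd [set x] [set x] = deg e x.
Proof.
rewrite bndxx arcsE big_set1; apply: eq_card => v; rewrite !inE.
by have [->|] := eqVneq v x; rewrite ?eI.
Qed.

Hypotheses (T2 : 1 < #|T|) (eC : connected e).

Lemma edge_conn_le_bnd A : proper_side A -> edge_conn e <= bnd A A.
Proof. by rewrite bndxx; apply: edge_conn_le. Qed.

Lemma edge_conn_le_min_deg : edge_conn e <= min_deg e.
Proof.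
have [x dx] := deg_le_min_deg e T2; apply: leq_trans dx.
by rewrite -bnd1 edge_conn_le_bnd ?proper_side1.
Qed.

Lemma edge_conn_gt0 : 0 < edge_conn e.
Proof.
have [A pA] := edge_conn_attained eS T2; apply: leq_trans.
exact: connected_arcs_gt0.
Qed.

Lemma gap_disjoint A B : A != set0 -> B != set0 -> A :&: B = set0 ->
  2 * edge_conn e <= gap A B.
Proof.
rewrite -!card_gt0 => A0 B0 AB; have BA : B :&: A = set0 by rewrite setIC.
have := bnd_min_disjoint AB; have := bnd_min_disjoint BA.
have := edge_conn_le_min_deg; rewrite /gap.
move: (bnd A B) (bnd B A) => a b; move: (min_deg e) (edge_conn e) => d l.
move: #|A| #|B| A0 B0 => p q p0 q0 ld hb ha.
(* If both sizes are at most [d], write d = p + s = q + t, which removes the truncated subtractions: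
   p(t + 1) + q(s + 1) is at least 2d as [p] and [q] are positive. *)
have [pd|dp] := leqP p d; have [qd|dq] := leqP q d.
- rewrite -[d](subnK pd) -[d](subnK qd) in ld hb ha *; nia.
- nia.
- nia.
- nia.
Qed.

Lemma gap_proper A B : proper_side A -> proper_side B ->
  2 * edge_conn e <= gap A B.
Proof.
move=> pA pB; case/andP: (pA) (pB) => A0 AT /andP[B0 BT].
have [AB|AB] := eqVneq (A :&: B) set0; first exact: gap_disjoint.
have [UAB|UAB] := eqVneq (A :|: B) [set: T].
  rewrite -gap_setC; apply: gap_disjoint.
  - by move: pA; rewrite -proper_sideC => /andP[].
  - by move: pB; rewrite -proper_sideC => /andP[].
  by rewrite -setCU UAB setCT.
(* Intersection and union are now both proper, so each contributes lambda. *)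
apply: leq_trans (gap_submod A B); rewrite mul2n -addnn leq_add // edge_conn_le_bnd //.
  rewrite /proper_side AB; apply: contraNneq AT => E.
  by rewrite eqEsubset subsetT /= -E subsetIl.
rewrite /proper_side UAB andbT; apply: contraNneq A0 => E.
by rewrite -subset0 -E subsetUl.
Qed.

(** Sharp when [A] and [B] are the same vertex of minimum degree d: (d + 1) + d + 2d + d. *)
Lemma two_layers A B : proper_side A -> proper_side B ->
  5 * min_deg e + 1 <= gap set0 A + bnd A A + gap A B + bnd B B.
Proof.
move=> pA pB; have := gap_proper pA pB.
have := edge_conn_le_bnd pA; have := edge_conn_le_bnd pB.
have := edge_conn_gt0; have := edge_conn_le_min_deg.
have := gap0_min A; have := bnd_min A A; have := bnd_min B B.
have : #|A| * ((min_deg e).+1 - #|B|) + #|B| * ((min_deg e).+1 - #|A|) <= gap A B.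
  by rewrite leq_add ?bnd_min.
case/andP: pA pB => A0 _ /andP[B0 _]; rewrite -!card_gt0 in A0 B0.
move: (gap A B) (bnd A A) (bnd B B) (gap set0 A) => g a b z.
move: (min_deg e) (edge_conn e) => d l.
move: #|A| #|B| A0 B0 => p q p0 q0.
move=> h1 h2 h3 h4 h5 h6 h7 h8 h9.
(* From five vertices on, [gap set0 A] alone gives 5(d + 1). Sizes 1 to 4 combine the degree bounds
   with those in lambda. *)
case: p p0 h1 h3 h4 => [|[|[|[|[|p]]]]] // _ h1 h3 h4; nia.
Qed.

(** Charging: each [w] in [A] pays [deg e w + 1 + out w]. Of this, [u] and [v] reserve their own
    [deg + out], and every [w] can still spare one unit per adjacency to [u] or [v]. These units
    number [deg - out] for each of [u] and [v], so the total is at least 2(deg u + deg v). *)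
Lemma one_layer A u v : u \in A -> v \in A -> e u v ->
  2 * min_edge_deg e + 4 <= gap set0 A + bnd A A.
Proof.
move=> uA vA euv.
have xi : min_edge_deg e <= deg e u + deg e v - 2.
  exact: (@bigminn_le _ (fun p : T * T => e p.1 p.2) _ _ (u, v)).
have du : 0 < deg e u by apply/card_gt0P; exists v; rewrite inE.
have dv : 0 < deg e v by apply/card_gt0P; exists u; rewrite inE eS.
have uv : u != v by apply/eqP=> E; rewrite E eI in euv.
pose out w := #|[set x in ~: A | e w x]|.
have degE w : deg e w = \sum_(x in A) e w x + out w.
  rewrite /deg -(cardsID A) (_ : _ :\: A = [set x in ~: A | e w x]); last first.
    by apply/setP=> x; rewrite !inE.
  congr (_ + _); rewrite -sum1_card [LHS]big_mkcond [RHS]big_mkcond /=.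
  by apply: eq_bigr => x _; rewrite !inE andbC; case: (x \in A); case: (e w x).
have mark (w : T) c : w \in A -> \sum_(x in A) (x == w) * c = c.
  move=> wA; rewrite (bigD1 w) //= eqxx mul1n big1 ?addn0 // => x /andP[_ /negbTE->].
  by rewrite mul0n.
have le_w w : w \in A -> e u w + e v w + (w == u) * (deg e u + out u)
    + (w == v) * (deg e v + out v) <= (deg e w).+1 + out w.
  move=> wA; have [->|wu] := eqVneq w u.
    by rewrite (negbTE uv) eI; lia.
  have [->|wv] := eqVneq w v; first by rewrite eI; lia.
  (* A third vertex may be adjacent to both [u] and [v]; it can pay 2 because its degree is
     positive. *)
  have [y ewy] := connected_deg_gt0 w T2 eC.
  have : 0 < deg e w by apply/card_gt0P; exists y; rewrite inE.
  lia.
rewrite gap0 bndxx arcsE -big_split /=; apply: leq_trans (leq_sum _ le_w).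
rewrite !big_split /= !mark //; have := degE u; have := degE v; lia.
Qed.

End Boundary.

(** * Cuts described by a sequence of layers along the path *)

Section Layers.
Variables (T : finType) (e : rel T).
Hypotheses (eS : symmetric e) (eI : irreflexive e).
Local Notation bnd := (bnd e).
Local Notation gap := (gap e).
Implicit Types (Y : nat -> {set T}).

(** Here [m] counts the edges of the path, so n = m + 1 and the layers are [Y 0] to [Y m]. *)
Definition layer_cut m Y : nat :=
  \sum_(k < m.+1) bnd (Y k) (Y k) + \sum_(k < m) gap (Y k) (Y k.+1).

Lemma layer_cut_setC m Y : layer_cut m (fun k => ~: Y k) = layer_cut m Y.
Proof.
congr (_ + _); apply: eq_bigr => k _; last by rewrite gap_setC.
by rewrite bndC.
Qed.

Lemma layer_cut_rev m Y : layer_cut m (fun k => Y (m - k)) = layer_cut m Y.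
Proof.
congr (_ + _); rewrite (reindex_inj rev_ord_inj); apply: eq_bigr => k _ /=.
  by rewrite subSS subKn // -ltnS.
by rewrite gapC; congr (gap (Y _) (Y _)); have := ltn_ord k; lia.
Qed.

Lemma gap_le_layer_gaps m Y k : k < m -> gap (Y k) (Y k.+1) <= \sum_(k < m) gap (Y k) (Y k.+1).
Proof. by move=> km; rewrite (bigD1 (Ordinal km)) //= leq_addr. Qed.

Lemma gap0_telescope Y i j : i <= j ->
  gap set0 (Y j) <= gap set0 (Y i) + \sum_(i <= k < j) gap (Y k) (Y k.+1).
Proof.
move=> ij; rewrite -(subnKC ij); elim: (j - i) => [|d IH].
  by rewrite addn0 big_geq // addn0.
rewrite addnS big_nat_recr ?leq_addr //= addnA.
by apply: leq_trans (gap0_le eS (Y (i + d)) _) _; rewrite leq_add2r.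
Qed.

Lemma gap_setT : gap set0 [set: T] = #|T| + 2 * nedges e.
Proof.
rewrite gap0 // -arcs_setT // arcsE; under eq_bigr do rewrite -add1n.
rewrite big_split /= sum1_card cardsT; congr (_ + _).
by apply: eq_bigr => u _; apply: eq_card => v; rewrite !inE.
Qed.

Lemma layer_cut_empty_full m Y i j : i <= j <= m -> Y i = set0 -> Y j = [set: T] ->
  #|T| + 2 * nedges e <= layer_cut m Y.
Proof.
move=> /andP[ij jm] Yi Yj; have := gap0_telescope Y ij.
rewrite Yi Yj gap00 add0n gap_setT => le_s.
apply: leq_trans (leq_addl _ _); rewrite -(big_mkord xpredT (fun k => gap (Y k) (Y k.+1))).
rewrite (big_cat_nat (n := i)) //=; last exact: leq_trans jm.
rewrite (big_cat_nat (m := i) (n := j)) //=.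
by apply: leq_trans le_s _; rewrite addnCA leq_addr.
Qed.

Hypotheses (T2 : 1 < #|T|) (eC : connected e).

Lemma layer_cut_all_proper m Y : (forall k, k <= m -> proper_side (Y k)) ->
  (3 * m + 1) * edge_conn e <= layer_cut m Y.
Proof.
(* The m + 1 layers pay lambda each and the m gaps 2 lambda each. *)
move=> pY; have -> : (3 * m + 1) * edge_conn e = m.+1 * edge_conn e + m * (2 * edge_conn e) by lia.
have sum_ge q (F : nat -> nat) c : (forall k, k < q -> c <= F k) -> q * c <= \sum_(k < q) F k.
  by move=> cF; rewrite -{1}[q]card_ord -sum_nat_const leq_sum // => k _; apply: cF.
apply: leq_add.
  apply: (sum_ge _ (fun k => bnd (Y k) (Y k))) => k km.
  exact: edge_conn_le_bnd (pY _ km).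
apply: (sum_ge _ (fun k => gap (Y k) (Y k.+1))) => k km.
by apply: gap_proper => //; apply: pY => //; apply: ltnW.
Qed.

(** What [no_isolated] leaves on the slices: the same-side neighbour of a vertex lies in its own
    layer or in an adjacent one. *)
Definition layers_no_isolated m Y := forall k, k <= m -> Y k != set0 ->
  (exists u v, [/\ u \in Y k, v \in Y k & e u v]) \/
  (exists l, [/\ l <= m, l = k.+1 \/ k = l.+1 & Y l != set0]).

(** The four-term minimum of the theorem for n = m + 1, where 3n - 2 = 3m + 1. *)
Definition min4 m : nat :=
  minn (minn ((3 * m + 1) * edge_conn e) (#|T| + 2 * nedges e))
       (minn (2 * min_edge_deg e + 4) (5 * min_deg e + 1)).

Lemma layer_cut_step m Y k : layers_no_isolated m Y ->
  (forall k, k <= m -> Y k != [set: T]) ->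
  k < m -> Y k = set0 -> Y k.+1 != set0 -> min4 m <= layer_cut m Y.
Proof.
move=> iY fY km Yk Yk1; rewrite /min4 geq_min; apply/orP; right; rewrite geq_min.
have g0 : gap (Y k) (Y k.+1) = gap set0 (Y k.+1) by rewrite Yk.
(* If layer [k.+1] is the last one, its only adjacent layer is empty, so its slice must contain an
   edge. *)
have [km1|mk1] := ltnP k.+1 m; last first.
  apply/orP; left; have := iY _ km Yk1.
  case=> [[u [v [uY vY euv]]]|[l [lm [El|El] Yl]]]; first last.
  - by rewrite -(succn_inj El) Yk eqxx in Yl.
  - by move: lm mk1; rewrite El; lia.
  apply: leq_trans (one_layer eS eI T2 eC uY vY euv) _.
  rewrite addnC leq_add //; last by rewrite -g0; apply: gap_le_layer_gaps.
  by rewrite (bigD1 (Ordinal (km : k.+1 < m.+1))) //= leq_addr.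
have gaps : gap set0 (Y k.+1) + gap (Y k.+1) (Y k.+2) <= \sum_(k < m) gap (Y k) (Y k.+1).
  rewrite (bigD1 (Ordinal km)) //= (bigD1 (Ordinal km1)) /=; last by rewrite -val_eqE /=; lia.
  by rewrite g0 addnA leq_addr.
have bnds : bnd (Y k.+1) (Y k.+1) + bnd (Y k.+2) (Y k.+2) <= \sum_(k < m.+1) bnd (Y k) (Y k).
  rewrite (bigD1 (Ordinal (km : k.+1 < m.+1))) //= (bigD1 (Ordinal (km1 : k.+2 < m.+1))) /=.
    by rewrite addnA leq_addr.
  by rewrite -val_eqE /=; lia.
(* An empty layer [k.+2] again forces an edge inside [Y k.+1]; a nonempty one brings in
   [two_layers]. *)
have [Yk2|Yk2] := eqVneq (Y k.+2) set0; apply/orP; [left|right].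
  have := iY _ km Yk1.
  case=> [[u [v [uY vY euv]]]|[l [lm [El|El] Yl]]]; first last.
  - by rewrite -(succn_inj El) Yk eqxx in Yl.
  - by rewrite El Yk2 eqxx in Yl.
  apply: leq_trans (one_layer eS eI T2 eC uY vY euv) _.
  rewrite /layer_cut; lia.
have p1 : proper_side (Y k.+1) by rewrite /proper_side Yk1 fY.
have p2 : proper_side (Y k.+2) by rewrite /proper_side Yk2 fY.
apply: leq_trans (two_layers eS eI T2 eC p1 p2) _; rewrite /layer_cut; lia.
Qed.

Lemma first_change (P : pred nat) i j : i < j -> P i -> ~~ P j ->
  exists k, [/\ i <= k, k < j, P k & ~~ P k.+1].
Proof.
move=> ij Pi; rewrite -(subnKC ij); elim: (j - i.+1) => [|d IH].
  by rewrite addn0 => Pj; exists i.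
rewrite addnS => nP; case Pd: (P (i.+1 + d)).
  by exists (i.+1 + d); split=> //; lia.
by have [|k [? ? ? ?]] := IH; rewrite ?Pd //; exists k; split=> //; lia.
Qed.

Lemma layer_cut_some_empty m Y i j : layers_no_isolated m Y ->
  (forall k, k <= m -> Y k != [set: T]) ->
  i <= m -> Y i = set0 -> j <= m -> Y j != set0 -> min4 m <= layer_cut m Y.
Proof.
move=> iY fY im Yi jm Yj.
have ij : i != j by apply: contraNneq Yj => <-; rewrite Yi.
wlog lt_ij : i j Y iY fY im Yi jm Yj ij / i < j => [W|].
  have [lt_ij|] := ltnP i j; first exact: (W i j).
  rewrite leq_eqVlt eq_sym (negbTE ij) /= => ji; rewrite -layer_cut_rev.
  apply: (W (m - i) (m - j)); rewrite ?leq_subr ?subKn //; try lia.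
  - move=> k km /(iY _ (leq_subr k m))[|[l [lm kl Yl]]]; first by left.
    by right; exists (m - l); rewrite subKn //; split=> //; lia.
  - by move=> k km; apply: fY; rewrite leq_subr.
have Pi : Y i == set0 by apply/eqP.
have [k [ik kj /eqP Yk Yk1]] := @first_change (fun k => Y k == set0) _ _ lt_ij Pi Yj.
by apply: (layer_cut_step (k := k)) => //; apply: leq_trans kj jm.
Qed.

Lemma layer_cut_min4 m Y :
  layers_no_isolated m Y -> layers_no_isolated m (fun k => ~: Y k) ->
  (exists2 i, i <= m & Y i != set0) -> (exists2 i, i <= m & Y i != [set: T]) ->
  min4 m <= layer_cut m Y.
Proof.
move=> iY iCY [j jm Yj] [j' j'm Yj'].
have eqC A B : (~: A == B) = (A == ~: B :> {set T}).
  by rewrite -{1}[B]setCK (inj_eq (@setC_inj T)).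
(* Four cases: an empty and a full layer, only an empty one, only a full one (handled by
   complementing), neither. *)
have [/existsP[i /eqP Yi]|/existsPn noE] := boolP [exists i : 'I_m.+1, Y i == set0];
have [/existsP[i' /eqP Yi']|/existsPn noF] := boolP [exists i : 'I_m.+1, Y i == [set: T]].
- rewrite /min4 !geq_min; apply/orP; left; apply/orP; right.
  have [ii'|/ltnW i'i] := leqP i i'.
    by apply: (layer_cut_empty_full (i := i) (j := i')); rewrite // ii' leq_ord.
  rewrite -layer_cut_setC //; apply: (layer_cut_empty_full (i := i') (j := i)).
  - by rewrite i'i leq_ord.
  - by rewrite Yi' setCT.
  - by rewrite Yi setC0.
- apply: (layer_cut_some_empty (i := i) (j := j)) => //; last exact: leq_ord.
  by move=> k km; apply: (noF (Ordinal (km : k < m.+1))).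
- rewrite -layer_cut_setC //.
  apply: (layer_cut_some_empty (i := i') (j := j')) => //.
  + by move=> k km; rewrite eqC setCT; apply: (noE (Ordinal (km : k < m.+1))).
  + exact: leq_ord.
  + by rewrite Yi' setCT.
  by rewrite eqC setC0.
rewrite /min4 !geq_min layer_cut_all_proper // => k km.
have := noE (Ordinal (km : k < m.+1)); have := noF (Ordinal (km : k < m.+1)).
by rewrite /proper_side /= => -> ->.
Qed.

End Layers.

(** Each adjacency of the path is split into an upward and a downward direction; for a fixed
    starting index each direction has at most one nonzero term, and none at the top index. *)
Lemma sum_path_rel m (F : nat -> nat -> nat) :
  \sum_(i < m.+1) \sum_(j < m.+1) path_rel m.+1 i j * F i j =
  \sum_(k < m) (F k k.+1 + F k.+1 k).
Proof.
pose up (i j : nat) := (i.+1 == j) * F i j; pose dn (i j : nat) := (j.+1 == i) * F i j.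
have pick n (a : nat) (G : nat -> nat) :
    \sum_(j < n) (a == j :> nat) * G j = if a < n then G a else 0.
  case: ltnP => an.
    rewrite (bigD1 (Ordinal an)) //= eqxx mul1n big1 ?addn0 // => j.
    by rewrite -val_eqE /= eq_sym => /negbTE->.
  by rewrite big1 // => j _; case: eqP => // E; have := ltn_ord j; rewrite -E ltnNge an.
transitivity (\sum_(i < m.+1) \sum_(j < m.+1) up i j +
              \sum_(j < m.+1) \sum_(i < m.+1) dn i j).
  rewrite [X in _ + X]exchange_big -big_split; apply: eq_bigr => i _ /=.
  rewrite -big_split; apply: eq_bigr => j _ /=.
  rewrite /up /dn /path_rel -mulnDl; congr (_ * _).
  by do 2!case: eqP => //; lia.
rewrite big_split /= /up /dn; congr (_ + _).
  under eq_bigr => i _ do rewrite (pick m.+1 i.+1 (F i)).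
  by rewrite big_ord_recr /= ltnn addn0; apply: eq_bigr => k _; rewrite ltnS ltn_ord.
under eq_bigr => j _ do rewrite (pick m.+1 j.+1 (F ^~ j)).
by rewrite big_ord_recr /= ltnn addn0; apply: eq_bigr => k _; rewrite ltnS ltn_ord.
Qed.

(** * The strong product with a path, slice by slice *)

Section Product.
Variables (T : finType) (e : rel T) (m : nat).
Hypotheses (eS : symmetric e) (eI : irreflexive e).
Local Notation H := (strong e (path_rel m.+1)).

Lemma strong_path_sym : symmetric H.
Proof.
move=> [u i] [v j]; rewrite /strong /path_rel /= eS.
by rewrite ![_ == u]eq_sym ![_ == i]eq_sym [(j.+1 == _) || _]orbC.
Qed.

Lemma strong_path_irr : irreflexive H.
Proof.
move=> [u i]; rewrite /strong /path_rel /= eI !eqxx /= orbF orbb.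
by rewrite gtn_eqF.
Qed.

(** Vertical and diagonal edges merge into one [rcl] condition between adjacent layers. *)
Lemma strong_pathE u (i : 'I_m.+1) v (j : 'I_m.+1) :
  H (u, i) (v, j) = (i == j) && e u v || path_rel m.+1 i j && rcl e u v.
Proof.
rewrite /strong /rcl /=; case: (u == v); case: (i == j); case: (e u v);
  by case: (path_rel _ _ _).
Qed.

(** [inord] allows indices in [nat]; it returns the intended layer only for [k <= m]. *)
Definition slice (X : {set T * 'I_m.+1}) (k : nat) : {set T} :=
  [set u | (u, inord k) \in X].

Lemma mem_slice X u (i : 'I_m.+1) : (u \in slice X i) = ((u, i) \in X).
Proof. by rewrite inE inord_val. Qed.

Lemma sliceC X k : slice (~: X) k = ~: slice X k.
Proof. by apply/setP=> u; rewrite !inE. Qed.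

Lemma sum_layers (G : T * 'I_m.+1 -> nat) : \sum_p G p = \sum_i \sum_u G (u, i).
Proof. by rewrite exchange_big pair_bigA; apply: eq_bigr => -[]. Qed.

Lemma arcs_slices X : arcs H X (~: X) = layer_cut e m (slice X).
Proof.
rewrite /layer_cut -(sum_path_rel m (fun i j => bnd e (slice X i) (slice X j))).
rewrite -big_split /= /arcs.
transitivity (\sum_(i < m.+1) \sum_(j < m.+1) \sum_u \sum_v
   [&& (u, i) \in X, (v, j) \notin X & H (u, i) (v, j)]).
  rewrite sum_layers; apply: eq_bigr => i _; rewrite [RHS]exchange_big; apply: eq_bigr => u _ /=.
  by rewrite sum_layers; do 2!apply: eq_bigr => ? _; rewrite inE.
apply: eq_bigr => i _.
(* The in-layer term is spread over [j] with weight [i == j], so that both sides are sums over the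
   same index pairs. *)
have -> : bnd e (slice X i) (slice X i) =
  \sum_(j < m.+1) (i == j) * arcs e (slice X i) (~: slice X j).
  rewrite (bigD1 i) //= eqxx mul1n big1 ?addn0 ?bndxx // => j.
  by rewrite eq_sym => /negbTE->.
rewrite -big_split /=; apply: eq_bigr => j _; rewrite /bnd /arcs !big_distrr -big_split /=.
apply: eq_bigr => u _; rewrite !big_distrr -big_split /=; apply: eq_bigr => v _.
rewrite strong_pathE !inE !inord_val; case: (_ \in X); case: (_ \in X); rewrite ?muln0 //=.
(* No index is path-adjacent to itself, so the two alternatives of [strong_pathE] exclude each other
   and the disjunction agrees with the sum. *)
have [->|] := eqVneq i j; last by case: path_rel; case: rcl; rewrite ?andbF.
by rewrite /path_rel gtn_eqF //=; case: (e u v).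
Qed.

End Product.

(** * The lower bound for cuts of the product, and sides attaining the four values *)

Section ProductCuts.
Variables (T : finType) (e : rel T) (m : nat).
Hypotheses (eS : symmetric e) (eI : irreflexive e).
Local Notation H := (strong e (path_rel m.+1)).
Implicit Types (X : {set T * 'I_m.+1}) (Y : nat -> {set T}).

Lemma slices_no_isolated X : no_isolated H X -> layers_no_isolated e m (slice X).
Proof.
move=> iX k km /set0Pn[u]; rewrite inE => uX.
have [[v j]] := iX (u, inord k); rewrite strong_pathE uX => /orP[/andP[/eqP<- euv] vX|].
  by left; exists u, v; rewrite !inE.
case/andP=> kj _ vX; right; exists j; split; first exact: leq_ord.
  by case/orP: kj; rewrite inordK // => /eqP; [left|right].
by apply/set0Pn; exists v; rewrite mem_slice.
Qed.

Lemma no_isolatedC X : no_isolated H X -> no_isolated H (~: X).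
Proof. by move=> iX p; have [q pq qX] := iX p; exists q; rewrite // !inE qX. Qed.

Lemma min4_le_arcs X : 1 < #|T| -> connected e ->
  proper_side X -> no_isolated H X -> min4 e m <= arcs H X (~: X).
Proof.
move=> T2 eC /proper_sideP[[u i] [[v j] [uX vX]]] iX; rewrite arcs_slices //.
apply: layer_cut_min4 => //.
- exact: slices_no_isolated.
- move=> k km; have := slices_no_isolated (no_isolatedC iX) km; rewrite sliceC => h /h[|[l]].
    by left.
  by rewrite sliceC; right; exists l.
- by exists i; rewrite ?leq_ord //; apply/set0Pn; exists u; rewrite mem_slice.
exists j; rewrite ?leq_ord //; apply: contraNneq vX => E.
by rewrite -mem_slice E inE.
Qed.

(** Inverse of [slice] on layers 0 to [m], to build witnesses from their layers. *)
Definition tower Y : {set T * 'I_m.+1} :=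
  [set p : T * 'I_m.+1 | p.1 \in Y p.2].

Definition layer_adj u (k : nat) v (l : nat) :=
  (k == l) && e u v || ((k.+1 == l) || (l.+1 == k)) && rcl e u v.

Definition tower_no_isolated Y := forall u k, k <= m ->
  exists v l, [/\ l <= m, layer_adj u k v l & (v \in Y l) = (u \in Y k)].

Lemma no_isolated_tower Y : tower_no_isolated Y -> no_isolated H (tower Y).
Proof.
move=> iY [u k]; have [v [l [lm uv vY]]] := iY u k (leq_ord k).
exists (v, Ordinal (lm : l < m.+1)); last by rewrite !inE.
by rewrite strong_pathE -val_eqE.
Qed.

Lemma arcs_tower Y : arcs H (tower Y) (~: tower Y) = layer_cut e m Y.
Proof.
rewrite arcs_slices //; have sY k : k <= m -> slice (tower Y) k = Y k.
  by move=> km; apply/setP=> u; rewrite !inE /= inordK.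
congr (_ + _); apply: eq_bigr => k _; rewrite !sY ?leq_ord //.
exact: ltnW.
Qed.

Lemma redge_conn_le_tower Y u k v l :
  k <= m -> u \in Y k -> l <= m -> v \notin Y l -> tower_no_isolated Y ->
  redge_conn H <= layer_cut e m Y.
Proof.
move=> km uY lm vY iY; rewrite -arcs_tower; apply: redge_conn_le.
- exact: strong_path_sym.
- exact: strong_path_irr.
- apply/proper_sideP; exists (u, Ordinal (km : k < m.+1)), (v, Ordinal (lm : l < m.+1)).
  by rewrite !inE.
exact: no_isolated_tower.
Qed.

Hypotheses (T2 : 1 < #|T|) (eC : connected e) (m1 : 0 < m).

Lemma vertical_neighbor u k : k <= m ->
  exists l, [/\ l <= m, layer_adj u k u l & l = k.+1 \/ k = l.+1].
Proof.
rewrite /layer_adj /rcl eqxx /= => km; case: k km => [|k] km.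
  by exists 1; rewrite eqxx; split=> //; left.
by exists k; rewrite eqxx !orbT; split=> //; [lia|right].
Qed.

Lemma constant_tower_no_isolated A : tower_no_isolated (fun=> A).
Proof.
by move=> u k km; have [l [lm ul _]] := vertical_neighbor u km; exists u, l.
Qed.

Lemma redge_conn_le_edge_conn : redge_conn H <= (3 * m + 1) * edge_conn e.
Proof.
have [A /proper_sideP[u [v [uA vA]]] le_A] := edge_conn_attained eS T2.
apply: leq_trans (redge_conn_le_tower (leq0n m) uA (leq0n m) vA (@constant_tower_no_isolated A)) _.
(* With equal layers each gap is twice the in-layer cut, giving the factor (m + 1) + 2m. *)
rewrite /layer_cut !sum_nat_const !card_ord /gap bndxx //; nia.
Qed.

Definition bottom A (k : nat) : {set T} := if k == 0 then A else set0.

Lemma layer_cut_bottom A : layer_cut e m (bottom A) = bnd e A A + gap e set0 A.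
Proof.
rewrite /layer_cut big_ord_recl big1 ?addn0 => [|k _]; last by rewrite bnd0.
(* As [m] is positive, layer 1 exists and exactly one gap term survives. *)
case: m m1 => // m' _; rewrite big_ord_recl big1 ?addn0 => [|k _]; last by rewrite gap00.
by rewrite gapC.
Qed.

Lemma redge_conn_le_bottom_layer : redge_conn H <= #|T| + 2 * nedges e.
Proof.
have /card_gt0P[x _] : 0 < #|T| by apply: leq_trans T2.
have xY : x \in bottom [set: T] 0 by rewrite inE.
have xY1 : x \notin bottom [set: T] 1 by rewrite inE.
apply: leq_trans (redge_conn_le_tower (leq0n m) xY m1 xY1 _) _.
  move=> u k km; have [v euv] := connected_deg_gt0 u T2 eC; exists v, k.
  by rewrite /layer_adj eqxx euv /bottom; split=> //; case: (k == 0); rewrite !inE.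
rewrite layer_cut_bottom gap_setT //.
(* A full layer has no boundary within itself; only the gap to layer 1 is paid. *)
by rewrite -bndC // setCT bnd0.
Qed.

Lemma redge_conn_le_min_edge_deg : redge_conn H <= 2 * min_edge_deg e + 4.
Proof.
have [x [y [exy le_xy]]] := edge_deg_le_min_edge_deg T2 eC.
have xy : x != y by apply/eqP=> E; rewrite E eI in exy.
have xY : x \in bottom [set x; y] 0 by rewrite set21.
have xY1 : x \notin bottom [set x; y] 1 by rewrite inE.
apply: leq_trans (redge_conn_le_tower (leq0n m) xY m1 xY1 _) _.
  move=> u [|k] km; last first.
    have [v euv] := connected_deg_gt0 u T2 eC; exists v, k.+1.
    by rewrite /layer_adj eqxx euv !inE.
  have [->|ux] := eqVneq u x.
    by exists y, 0; rewrite /layer_adj /= exy !inE !eqxx orbT.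
  have [->|uy] := eqVneq u y.
    by exists x, 0; rewrite /layer_adj /= eS exy !inE !eqxx orbT.
  (* Any other vertex of layer 0 is outside the side, and so is its copy in layer 1. *)
  by exists u, 1; rewrite /layer_adj /rcl !eqxx !inE (negbTE ux) (negbTE uy).
rewrite layer_cut_bottom gap0 // bndxx // arcsE.
have dx : 0 < deg e x by apply/card_gt0P; exists y; rewrite inE.
have dy : 0 < deg e y by apply/card_gt0P; exists x; rewrite inE eS.
(* Each of [x] and [y] has the other inside, so the cut has at most (dx + 1) + (dy + 1) + (dx - 1) +
   (dy - 1) = 2(dx + dy) edges. *)
have out z w : e z w -> z \in [set x; y] -> w \in [set x; y] ->
  #|[set v in ~: [set x; y] | e z v]| <= (deg e z).-1.
  move=> ezw zxy wxy; rewrite /deg (cardsD1 w [set v | e z v]) inE ezw /=.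
  apply/subset_leq_card/subsetP=> v; rewrite !inE negb_or => /andP[/andP[vx vy] ->].
  by move: wxy; rewrite !inE andbT => /orP[]/eqP->.
have outx := out x y exy (set21 _ _) (set22 _ _).
have eyx : e y x by rewrite eS.
have outy := out y x eyx (set22 _ _) (set21 _ _).
rewrite !big_setU1 ?inE //= !big_set1; lia.
Qed.

Lemma redge_conn_le_min_deg : redge_conn H <= 5 * min_deg e + 1.
Proof.
have [m2|m2] := ltnP 1 m; last first.
  apply: leq_trans redge_conn_le_edge_conn _.
  have := edge_conn_le_min_deg eS eI T2; nia.
have [x le_x] := deg_le_min_deg e T2.
(* Two stacked copies of [x], each the same-side neighbour of the other. *)
pose Y k := if k <= 1 then [set x] else set0 : {set T}.
have xY : x \in Y 0 by rewrite inE.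
have xY2 : x \notin Y 2 by rewrite inE.
apply: leq_trans (redge_conn_le_tower _ xY m2 xY2 _) _ => //.
  move=> u k km; have [->|ux] := eqVneq u x.
    case: k km => [|[|k]] km.
    - by exists x, 1; rewrite /layer_adj /rcl !eqxx !inE.
    - by exists x, 0; rewrite /layer_adj /rcl !eqxx !inE.
    have [v euv] := connected_deg_gt0 x T2 eC; exists v, k.+2.
    by rewrite /layer_adj eqxx euv !inE.
  have [l [lm ul _]] := vertical_neighbor u km; exists u, l; split=> //.
  have uY j : (u \in Y j) = false by rewrite /Y; case: ifP; rewrite !inE ?(negbTE ux).
  by rewrite !uY.
(* The cost is deg x in each of layers 0 and 1, 2 deg x between them, and deg x + 1 towards layer
   2. *)
rewrite /layer_cut; case: m m2 => [|[|m']] // _.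
rewrite !big_ord_recl /= !big1 => [|k _|k _]; last 2 first.
- by rewrite gap00.
- by rewrite bnd0.
rewrite /Y /= (gapC _ [set x] set0) gap0 // big_set1 /gap !bnd1 // bnd0; lia.
Qed.

End ProductCuts.

Theorem theorem3p1 (T : finType) (e : rel T) (n : nat) :
  symmetric e -> irreflexive e ->
  1 < #|T| -> connected e -> 2 <= n ->
  redge_conn (strong e (path_rel n)) =
  minn (minn ((3 * n - 2) * edge_conn e) (#|T| + 2 * nedges e))
       (minn (2 * min_edge_deg e + 4) (5 * min_deg e + 1)).
Proof.
move=> eS eI T2 eC; case: n => // m m1.
have -> : 3 * m.+1 - 2 = 3 * m + 1 by lia.
apply/eqP; rewrite eqn_leq !leq_min redge_conn_le_edge_conn ?redge_conn_le_bottom_layer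
  ?redge_conn_le_min_edge_deg ?redge_conn_le_min_deg //=.
have [|A [pA iA le_A]] := redge_conn_attained (strong_path_sym (m := m) eS).
  have /card_gt0P[x _] : 0 < #|T| by apply: leq_trans T2.
  (* The column over one vertex shows that the product has a restricted cut, which settles the
     default value. *)
  exists (tower m (fun=> [set x])); last exact/no_isolated_tower/constant_tower_no_isolated.
  have /proper_sideP[u [v [ux vx]]] := proper_side1 x T2.
  by apply/proper_sideP; exists (u, ord0), (v, ord0); rewrite !inE in ux vx *.
by apply: leq_trans le_A; apply: min4_le_arcs.
Qed.
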